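(* For every integer $d>1$ there exists an explicit monomial $\alpha$ of degree $d$ in two non-commuting variables $x_0,x_1$ (i.e. $\alpha=\prod_{i=1}^d x_{\sigma_i}$ for an explicit $\sigma\in\{0,1\}^d$) such that every homogeneous non-commutative arithmetic circuit computing $\alpha$ has non-scalar size $\Omega(d/\log d)$.
   Context: Let $\mathbb{F}$ be an arbitrary fixed field. Non-commutative polynomials over $\mathbb{F}$ are elements of the free algebra $\mathbb{F}\langle x_1,\dots,x_n\rangle$ (variables commute with scalars and additively, but not multiplicatively). A polynomial is homogeneous if all its monomials with non-zero coefficient have the same degree. A non-commutative arithmetic circuit is a directed acyclic graph whose in-degree-zero nodes (input gates) are labelled by variables or field elements, and whose other nodes have in-degree two and are labelled $+$ or $\times$; the two edges into a $\times$ gate are labelled left and right, indicating the order of multiplication. Each gate computes a non-commutative polynomial in the obvious way; the circuit computes $f$ if some gate (not necessarily an output gate) computes $f$. The circuit is homogeneous if every gate computes a homogeneous polynomial. A product gate is non-scalar if both of its inputs compute non-constant polynomials; the non-scalar size of a circuit is its number of non-scalar product gates. *)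

(* Defs.v *)
From HB Require Import structures.
From mathcomp Require Import all_boot all_order all_algebra.
From mathcomp Require Import finmap monalg.
From mathcomp Require Import reals exp.

Set Implicit Arguments.
Unset Strict Implicit.
Unset Printing Implicit Defensive.

Import GRing.Theory.
Local Open Scope ring_scope.

(* The free algebra F<x_i : i in I>, as the monoid algebra over F of the free
   monoid on I. *)
Notation ncpoly F I := {malg F[{fmonom I}]}.

Definition ncvar (F : fieldType) (I : choiceType) (i : I) : ncpoly F I :=
  << fmu i >>.

Definition ncmonomial (F : fieldType) (I : choiceType) (s : seq I) :
    ncpoly F I :=
  \prod_(i <- s) ncvar F i.

(* In particular the zero polynomial is homogeneous. *)
Definition homogeneous (F : fieldType) (I : choiceType) (p : ncpoly F I) :
    Prop :=
  exists k : nat, forall m, m \in msupp p -> fdeg m = k.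

Definition constant_poly (F : fieldType) (I : choiceType) (p : ncpoly F I) :
    bool :=
  p == (mcoeff mone p)%:MP.

(* The arguments of [Sum] and [Prod] are the sources of the two incoming edges,
   which may coincide; those of [Prod] are the left and the right factor. *)
Inductive gate_label (F I V : Type) :=
| Var of I
| Const of F
| Sum of V & V
| Prod of V & V.
Arguments Var {F I V}.
Arguments Const {F I V}.
Arguments Sum {F I V}.
Arguments Prod {F I V}.

Definition wire (F I : Type) (V : eqType) (lab : V -> gate_label F I V) :
    rel V :=
  fun u v => match lab v with
             | Sum l r | Prod l r => (u == l) || (u == r)
             | _ => false
             end.

Record circuit (F : fieldType) (I : choiceType) := Circuit {
  gate : finType;
  label : gate -> gate_label F I gate;
  acyclic : forall u v, wire label u v -> ~~ connect (wire label) v u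
}.
Arguments label {F I} c.

(* Unfolding the graph below [v] down to depth [n]; as the graph is acyclic,
   #|gate c| levels reach all the input gates (see gate_polyE). *)
Fixpoint unfold_gate (F : fieldType) (I : choiceType) (c : circuit F I)
    (n : nat) (v : gate c) : ncpoly F I :=
  if n is n'.+1 then
    match label c v with
    | Var i => ncvar F i
    | Const a => a%:MP
    | Sum l r => unfold_gate n' l + unfold_gate n' r
    | Prod l r => unfold_gate n' l * unfold_gate n' r
    end
  else 0.

Definition gate_poly (F : fieldType) (I : choiceType) (c : circuit F I)
    (v : gate c) : ncpoly F I :=
  unfold_gate #|gate c| v.

Section GatePolyE.
Variables (F : fieldType) (I : choiceType) (c : circuit F I).

Let below (v : gate c) := [set u | connect (wire (label c)) u v].

Let belowW u v : wire (label c) u v -> (#|below u| < #|below v|)%N.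
Proof.
move=> uv; apply/proper_card/properP; split.
  apply/subsetP => w; rewrite !inE => wu.
  exact: connect_trans wu (connect1 uv).
by exists v; rewrite !inE ?connect0 // acyclic.
Qed.

Let unfold_gate_stable n m v : (#|below v| <= n)%N -> (#|below v| <= m)%N ->
  unfold_gate n v = unfold_gate m v.
Proof.
have pos w : (0 < #|below w|)%N by apply/card_gt0P; exists w; rewrite inE.
elim: n m v => [|n IH] [|m] v.
- by [].
- by rewrite leqNgt pos.
- by move=> _; rewrite leqNgt pos.
move=> len lem /=.
have IHw u : wire (label c) u v -> unfold_gate n u = unfold_gate m u.
  move=> /belowW uv; apply: IH; rewrite -ltnS.
    exact: leq_trans uv len.
  exact: leq_trans uv lem.
move: IHw; rewrite /wire; case: (label c v) => // l r IHw;
  by rewrite !IHw ?eqxx ?orbT.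
Qed.

Lemma gate_polyE (v : gate c) :
  gate_poly v = match label c v with
                | Var i => ncvar F i
                | Const a => a%:MP
                | Sum l r => gate_poly l + gate_poly r
                | Prod l r => gate_poly l * gate_poly r
                end.
Proof.
rewrite {1}/gate_poly (@unfold_gate_stable _ #|gate c|.+1) ?max_card //.
exact: leqW (max_card _).
Qed.

End GatePolyE.

Definition computes (F : fieldType) (I : choiceType) (c : circuit F I)
    (p : ncpoly F I) : Prop :=
  exists v : gate c, gate_poly v = p.

Definition homogeneous_circuit (F : fieldType) (I : choiceType)
    (c : circuit F I) : Prop :=
  forall v : gate c, homogeneous (gate_poly v).

Definition nonscalar (F : fieldType) (I : choiceType) (c : circuit F I)
    (v : gate c) : bool :=
  if label c v is Prod l r then
    ~~ constant_poly (gate_poly l) && ~~ constant_poly (gate_poly r)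
  else false.

Definition nonscalar_size (F : fieldType) (I : choiceType) (c : circuit F I) :
    nat :=
  #|[set v : gate c | nonscalar v]|.

(* Deterministic multi-tape Turing machines on two-way infinite tapes over the
   alphabet {0, 1, blank}, where the blank is [None].  There are
   [tm_tapes.+1] tapes: tape [ord0] holds the input and tape [ord_max] the
   output.  The machine halts when [tm_trans] returns [None]. *)
Definition symbol := option bool.

Inductive direction := MoveLeft | Stay | MoveRight.

Definition move_head (a : direction) (i : int) : int :=
  match a with MoveLeft => i - 1 | Stay => i | MoveRight => i + 1 end.

Record turing_machine := TuringMachine {
  tm_tapes : nat;
  tm_state : finType;
  tm_start : tm_state;
  tm_trans : tm_state -> {ffun 'I_tm_tapes.+1 -> symbol} ->
    option (tm_state * ('I_tm_tapes.+1 -> symbol * direction))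
}.

Record tm_config (M : turing_machine) := TMConfig {
  cfg_state : tm_state M;
  cfg_tape : 'I_(tm_tapes M).+1 -> int -> symbol;
  cfg_head : 'I_(tm_tapes M).+1 -> int
}.

Definition tm_step (M : turing_machine) (x : tm_config M) :
    option (tm_config M) :=
  if tm_trans (cfg_state x) [ffun k => cfg_tape x k (cfg_head x k)]
    is Some (q, act)
  then Some (TMConfig q
    (fun k i => if i == cfg_head x k then (act k).1 else cfg_tape x k i)
    (fun k => move_head (act k).2 (cfg_head x k)))
  else None.

(* The halting configuration reached from [x] in at most [n] steps, if any. *)
Fixpoint tm_run (M : turing_machine) (n : nat) (x : tm_config M) :
    option (tm_config M) :=
  if tm_step x is Some y then
    if n is n'.+1 then tm_run n' y else None
  else Some x.

Definition word_tape (s : seq bool) (i : int) : symbol :=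
  if i is Posz j then nth None (map some s) j else None.

Definition tm_init (M : turing_machine) (s : seq bool) : tm_config M :=
  TMConfig (tm_start M)
    (fun k => if k == ord0 then word_tape s else fun=> None) (fun=> 0).

(* A family of words w d in {0,1}^d is explicit if one Turing machine, on the
   input d written in unary, outputs w d in time polynomial in d. *)
Definition explicit (w : forall d : nat, d.-tuple bool) : Prop :=
  exists (M : turing_machine) (K : nat), forall d : nat,
    exists2 x : tm_config M,
      tm_run (K * d.+1 ^ K)%N (tm_init M (nseq d true)) = Some x
      & forall i : int, cfg_tape x ord_max i = word_tape (w d) i.

(* Main.v *)
Require Import Defs.
From mathcomp Require Import all_boot all_order all_algebra.
From mathcomp Require Import finmap monalg.
From mathcomp Require Import reals exp.
From mathcomp Require Import zify lra.

Set Implicit Arguments.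
Unset Strict Implicit.
Unset Printing Implicit Defensive.

(* Fix a window length k.  For a homogeneous polynomial p and a position i, let
   p_i be the polynomial of degree k obtained from p by setting to 1 every
   variable outside the positions i, ..., i + k - 1.  The map p |-> p_i is
   linear, and for a product p * q it yields a multiple of a window of p or of q
   unless the window straddles the junction, which happens for k - 1 positions.
   So the windows of all the gates of a circuit with s non-scalar products span
   a space of dimension at most (k - 1) s, while the windows of a monomial are
   monomials, hence independent as soon as they are distinct.

   It remains to find an explicit word of length d whose windows of length
   O(log d) are distinct.  We take the bits emitted, one per step, by a machine
   that sweeps back and forth over a binary counter, spelling it while sweeping
   right and emitting zeros while sweeping left.  A window spanning two sweeps
   contains a whole value of the counter, which determines its position since
   the counter never repeats; and emitting the word takes d steps. *)

Import Order.TTheory GRing.Theory Num.Theory.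

(** * A counter swept by a real-time machine *)

(* Bijective base 2, least significant digit first: [false] is the digit 1 and
   [true] the digit 2, so every word is the numeral of exactly one number. *)
Fixpoint numeral_val (s : seq bool) : nat :=
  if s is b :: s' then b.+1 + (numeral_val s').*2 else 0.

Fixpoint numeral_succ (s : seq bool) : seq bool :=
  match s with
  | [::] => [:: false]
  | false :: s' => true :: s'
  | true :: s' => false :: numeral_succ s'
  end.

Lemma numeral_val_succ s : numeral_val (numeral_succ s) = (numeral_val s).+1.
Proof. by elim: s => [|[] s IHs] //=; rewrite IHs; lia. Qed.

Lemma expn2_size_numeral s : 2 ^ size s <= (numeral_val s).+1.
Proof. by elim: s => [|b s IHs] //=; rewrite expnS; lia. Qed.

Lemma size_numeral_succ s : size s <= size (numeral_succ s) <= (size s).+1.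
Proof. by elim: s => [|[] s IHs] //=; lia. Qed.

(* [Ask] and [Tell] sweep right with a carry and a head on the first letter not
   in [l]; [Back] sweeps left with a head on the first letter of [l], or on the
   blank left of the word if [l] is empty.  The word on the tape is [l] reversed
   followed by the rest. *)
Inductive sweep :=
| Ask of bool & seq bool & seq bool
| Tell of bool & seq bool & bool & seq bool
| Back of seq bool & seq bool.

(** In bijective base 2 as well, [cy (+) b] and [cy && b] are the new digit and carry: 1 + 1 = 2
    carries nothing, while 2 + 1 leaves 1 and carries 1. *)
Definition sweep_step (z : sweep) : sweep :=
  match z with
  | Ask cy l [::] => Back (if cy then false :: l else l) [::]
  | Ask cy l (b :: r) => Tell cy l b r
  | Tell cy l b r => Ask (cy && b) ((cy (+) b) :: l) r
  | Back [::] r => Ask true [::] r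
  | Back (b :: l) r => Back l (b :: r)
  end.

(** A right sweep emits each old digit b as the pair 1b and then a final 0, which delimits the
    numeral. *)
Definition sweep_out (z : sweep) : bool :=
  match z with
  | Ask _ _ r => r != [::]
  | Tell _ _ b _ => b
  | Back _ _ => false
  end.

Definition sweep_at (t : nat) : sweep := iter t sweep_step (Ask true [::] [::]).

Definition sweep_bit (t : nat) : bool := sweep_out (sweep_at t).

(* The value of the counter once the carry has been propagated. *)
Definition pending (z : sweep) : seq bool :=
  match z with
  | Ask cy l r => catrev l (if cy then numeral_succ r else r)
  | Tell cy l b r => catrev l (if cy then numeral_succ (b :: r) else b :: r)
  | Back l r => catrev l r
  end.

Lemma pending_step z :
  pending (sweep_step z) =
  if z is Back [::] r then numeral_succ r else pending z.
Proof. by case: z => [[] l [|b r]|[] l [] r|[|b l] r]. Qed.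

Lemma sweep_atS t : sweep_at t.+1 = sweep_step (sweep_at t).
Proof. by []. Qed.

Lemma numeral_val_pending_step z :
  numeral_val (pending z) <= numeral_val (pending (sweep_step z))
    <= (numeral_val (pending z)).+1.
Proof.
rewrite pending_step; case: z => [cy l r|cy l b r|[|b l] r] /=;
  by rewrite ?numeral_val_succ ?leqnSn ?leqnn.
Qed.

Lemma numeral_val_pending t : 0 < numeral_val (pending (sweep_at t)) <= t.+1.
Proof.
elim: t => // t IHt; rewrite sweep_atS.
by have := numeral_val_pending_step (sweep_at t); lia.
Qed.

Lemma numeral_val_pending_mono t u : t <= u ->
  numeral_val (pending (sweep_at t)) <= numeral_val (pending (sweep_at u)).
Proof.
move=> /subnKC <-; elim: (u - t) => [|n IHn]; first by rewrite addn0.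
rewrite addnS sweep_atS.
by have := numeral_val_pending_step (sweep_at (t + n)); lia.
Qed.

(* The bits 001 occur only where a new sweep starts. *)
Lemma sweep_marker z :
  ~~ sweep_out z -> ~~ sweep_out (sweep_step z) ->
  sweep_out (sweep_step (sweep_step z)) ->
  exists c, sweep_step z = Back [::] c.
Proof.
case: z => [cy l [|b r]|cy l b [|b' r]|[|b [|b' l]] r] //=.
- by case: cy l => [] [|a l] //=; exists [::].
- by case: r.
- by exists (b :: r).
Qed.

(** Steps [n] and [n.+1] emit the two zeros of a marker; the sweep that follows spells [c]. *)
Definition marker_after (z : sweep) (n : nat) (c : seq bool) :=
  ~~ sweep_out (iter n sweep_step z) /\ iter n.+1 sweep_step z = Back [::] c.

Lemma marker_afterS z n c :
  marker_after (sweep_step z) n c -> marker_after z n.+1 c.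
Proof. by rewrite /marker_after -!iterSr. Qed.

(** If [l] is empty, the first of the two zeros comes from [z]. *)
Lemma marker_after_back l r z : ~~ sweep_out z -> sweep_step z = Back l r ->
  exists2 n, n <= size l & marker_after z n (catrev l r).
Proof.
elim: l r z => [|b l IHl] r z z0 zE.
  by exists 0 => //; rewrite /marker_after /= zE.
have [//|//|n nl nE] := IHl (b :: r) (Back (b :: l) r).
by exists n.+1 => //; apply: marker_afterS; rewrite zE.
Qed.

(** Each digit of [r] costs two steps rightwards and one back, each digit of [l] one back, and a
    final carry may add a digit. *)
Lemma marker_after_ask cy l r :
  exists2 n, n <= 3 * size r + size l + 1
    & marker_after (Ask cy l r) n (pending (Ask cy l r)).
Proof.
elim: r cy l => [|b r IHr] cy l.
  have [n nl nE] := @marker_after_back _ _ (Ask cy l [::]) isT erefl.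
  exists n; first by move: nl; case: (cy) => /=; lia.
  by move: nE; case: (cy).
have [n nr nE] := IHr (cy && b) ((cy (+) b) :: l).
exists n.+2; first by move: nr => /=; lia.
do 2!apply: marker_afterS.
by move: nE => /=; case: (cy) (b) => [] [].
Qed.

Lemma marker_after_exists z :
  exists n c, [/\ n <= 3 * size (pending z) + 2, marker_after z n c
    & size c <= (size (pending z)).+1].
Proof.
have size_ask cy l r : size r + size l <= size (pending (Ask cy l r)).
  rewrite /= catrevE size_cat size_rev.
  by case: cy; have := size_numeral_succ r; lia.
case: z => [cy l r|cy l b r|[|b l] r].
- have [n nr nE] := marker_after_ask cy l r.
  exists n, (pending (Ask cy l r)); split=> //.
  by have := size_ask cy l r; lia.
- have [n nr nE] := marker_after_ask (cy && b) ((cy (+) b) :: l) r.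
  rewrite -[Ask _ _ _]/(sweep_step (Tell cy l b r)) pending_step in nE.
  exists n.+1, (pending (Tell cy l b r)); split=> //; last exact: marker_afterS.
  have := size_ask (cy && b) ((cy (+) b) :: l) r.
  rewrite -[Ask _ _ _]/(sweep_step (Tell cy l b r)) pending_step.
  by move: nr => /=; lia.
(* The first zero of a marker lies before [z] here, so a full further double sweep is needed. *)
- have [n nr nE] := marker_after_ask true [::] r.
  exists n.+1, (numeral_succ r); split; first by move: nr => /=; lia.
    exact: marker_afterS.
  by have /andP[] := size_numeral_succ r.
have [//|//|n nl nE] := @marker_after_back l (b :: r) (Back (b :: l) r).
exists n, (catrev l (b :: r)); split=> //.
by move: nl => /=; rewrite catrevE size_cat size_rev /=; lia.
Qed.

(** Even-numbered bits tell whether a digit follows, odd-numbered ones give the digit. *)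
Lemma ask_out_inj cy1 cy2 l1 l2 c1 c2 :
    (forall n, n <= 2 * size c1 ->
      sweep_out (iter n sweep_step (Ask cy1 l1 c1)) =
      sweep_out (iter n sweep_step (Ask cy2 l2 c2))) ->
  c1 = c2.
Proof.
elim: c1 cy1 cy2 l1 l2 c2 => [|b1 c1 IHc] cy1 cy2 l1 l2 [|b2 c2] //= eq_out.
- by have := eq_out 0 isT.
- by have := eq_out 0 isT.
have -> : b1 = b2 by apply: (eq_out 1); lia.
congr (_ :: _); apply: IHc => n nc.
by have := eq_out n.+2; rewrite !iterSr /=; apply; lia.
Qed.

Lemma sweep_atD t n : sweep_at (t + n) = iter n sweep_step (sweep_at t).
Proof. by rewrite addnC /sweep_at iterD. Qed.

(** The step out of [Back [::] c] increments the counter, which never decreases. *)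
Lemma sweep_back_inj t u c :
  sweep_at t = Back [::] c -> sweep_at u = Back [::] c -> t = u.
Proof.
wlog tu : t u / t <= u.
  by move=> H tc uc; have [/H->|/ltnW/H->] := leqP t u.
move=> tc uc; apply/eqP; rewrite eqn_leq tu leqNgt; apply/negP.
move=> /numeral_val_pending_mono; rewrite sweep_atS tc uc /=.
by rewrite numeral_val_succ ltnn.
Qed.

(** With p pending digits, a marker starts within 3p + 2 steps; its two zeros and the 2(p + 1) + 1
    bits spelling at most p + 1 digits bring the total to 5p + 7. *)
Lemma sweep_window_inj k i j :
    5 * size (pending (sweep_at i)) + 7 <= k ->
    (forall n, n < k -> sweep_bit (i + n) = sweep_bit (j + n)) ->
  i = j.
Proof.
move=> ik eq_ij.
have [n [c [ni [n0 nE] cs]]] := marker_after_exists (sweep_at i).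
rewrite -!sweep_atD in n0 nE.
have c0 : c != [::].
  by have := numeral_val_pending (i + n.+1); rewrite nE; case: (c).
have nE' : sweep_at (i + n.+2) = Ask true [::] c by rewrite addnS sweep_atS nE.
have [c' c'E] : exists c', sweep_at (j + n.+1) = Back [::] c'.
  rewrite addnS sweep_atS; apply: sweep_marker;
    rewrite -?sweep_atS -?addnS -/(sweep_bit _) -eq_ij /sweep_bit ?nE ?nE' //;
    lia.
have cc' : c = c'.
  apply: (@ask_out_inj true true [::] [::]) => m mc.
  have -> : Ask true [::] c' = sweep_at (j + n.+2).
    by rewrite addnS sweep_atS c'E.
  by rewrite -nE' -!sweep_atD -!addnA; apply: eq_ij; lia.
by have /addIn := sweep_back_inj nE (etrans c'E (congr1 _ (esym cc'))).
Qed.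

(** * The Turing machine emitting the word *)

Definition sweep_state (z : sweep) : option (bool * bool) :=
  match z with
  | Ask cy _ _ => Some (false, cy)
  | Tell cy _ _ _ => Some (true, cy)
  | Back _ _ => None
  end.

Definition sweep_word (z : sweep) : seq bool :=
  match z with
  | Ask _ l r => rev l ++ r
  | Tell _ l b r => rev l ++ b :: r
  | Back l r => rev l ++ r
  end.

Definition sweep_head (z : sweep) : int :=
  match z with
  | Ask _ l _ | Tell _ l _ _ => Posz (size l)
  | Back l _ => (Posz (size l) - 1)%R
  end.

Definition sweep_control (q : option (bool * bool)) (a : symbol) :
    option (bool * bool) * bool * (symbol * direction) :=
  match q, a with
  | Some (false, cy), None =>
      (None, false, if cy then (Some false, Stay) else (None, MoveLeft))
  | Some (false, cy), Some b => (Some (true, cy), true, (a, Stay))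
  | Some (true, cy), Some b =>
      (Some (false, cy && b), b, (Some (cy (+) b), MoveRight))
  | None, Some b => (None, false, (a, MoveLeft))
  | _, None => (Some (false, true), false, (None, MoveRight))
  end.

Local Arguments word_tape : simpl never.

Lemma word_tape_cat_rev l r : word_tape (rev l ++ r) (Posz (size l)) = ohead r.
Proof.
rewrite /word_tape map_cat nth_cat size_map size_rev ltnn subnn.
by case: r.
Qed.

Lemma word_tape_upd l r b b' i :
  (if i == Posz (size l) then Some b' else word_tape (rev l ++ b :: r) i) =
  word_tape (rev l ++ b' :: r) i.
Proof.
case: i => // n.
rewrite /word_tape !map_cat !nth_cat !size_map size_rev eqz_nat.
case: ltngtP => // [ln|->]; last by rewrite subnn.
by rewrite -(subnSK ln).
Qed.

Lemma word_tape_append l b i :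
  (if i == Posz (size l) then Some b else word_tape (rev l) i) =
  word_tape (rev l ++ [:: b]) i.
Proof.
case: i => // n; rewrite /word_tape map_cat nth_cat !size_map size_rev eqz_nat.
case: ltngtP => // [ln|->]; last by rewrite subnn.
by rewrite -(subnSK ln) nth_default ?size_map ?size_rev 1?ltnW //= nth_nil.
Qed.

Lemma sweep_control_correct z :
  let: (q, o, (a, dir)) :=
    sweep_control (sweep_state z) (word_tape (sweep_word z) (sweep_head z)) in
  [/\ q = sweep_state (sweep_step z), o = sweep_out z,
      move_head dir (sweep_head z) = sweep_head (sweep_step z)
    & forall i, (if i == sweep_head z then a else word_tape (sweep_word z) i) =
        word_tape (sweep_word (sweep_step z)) i].
Proof.
have headB (b : bool) l : (Posz (size (b :: l)) - 1)%R = Posz (size l).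
  by rewrite /=; lia.
case: z => [cy l [|b r]|cy l b r|[|b l] r].
- rewrite /= word_tape_cat_rev /=.
  case: cy; split=> // i; rewrite ?headB ?cats0 //.
    by rewrite word_tape_append rev_cons cats1.
  by case: eqP => [->|//]; rewrite -[rev l]cats0 word_tape_cat_rev.
- rewrite /= word_tape_cat_rev /=; split=> // i.
  by rewrite word_tape_upd.
- rewrite /= word_tape_cat_rev /=; split=> // [|i]; first by lia.
  by rewrite word_tape_upd rev_cons cat_rcons.
- by rewrite /=; split=> // i; case: eqP => [->|].
rewrite /= rev_cons cat_rcons -/(size (b :: l)) headB word_tape_cat_rev /=.
split=> // i.
by rewrite word_tape_upd.
Qed.

(** The input tape is a clock: its head advances at every step and the first blank halts the
    machine. The middle tape holds the counter. *)
Definition sweep_machine : turing_machine := @TuringMachine 2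
  (option (bool * bool)) (Some (false, true))
  (fun q a =>
     if a ord0 is None then None else
     let: (q', o, act) := sweep_control q (a 1%R) in
     Some (q', fun k : 'I_3 =>
       if k == ord0 then (a ord0, MoveRight)
       else if k == ord_max then (Some o, MoveRight) else act)).

Definition sweep_invariant (d t : nat) (x : tm_config sweep_machine) : Prop :=
  [/\ cfg_state x = sweep_state (sweep_at t),
      [/\ cfg_tape x ord0 =1 word_tape (nseq d true),
          cfg_tape x 1%R =1 word_tape (sweep_word (sweep_at t))
        & cfg_tape x ord_max =1 word_tape (mkseq sweep_bit t)]
    & [/\ cfg_head x ord0 = t, cfg_head x 1%R = sweep_head (sweep_at t)
        & cfg_head x ord_max = t]].

Lemma sweep_invariant_init d :
  sweep_invariant d 0 (tm_init sweep_machine (nseq d true)).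
Proof. by split=> //; split=> //; case=> // -[]. Qed.

Lemma sweep_invariant_halt d x : sweep_invariant d d x -> tm_step x = None.
Proof.
case=> _ [x0 _ _] [h0 _ _]; rewrite /tm_step /= ffunE x0 h0 /word_tape.
by rewrite nth_default // size_map size_nseq.
Qed.

Lemma sweep_invariant_step d t x : t < d -> sweep_invariant d t x ->
  exists2 y, tm_step x = Some y & sweep_invariant d t.+1 y.
Proof.
move=> td [xq [x0 x1 x2] [h0 h1 h2]].
have input_t : word_tape (nseq d true) t = Some true.
  by rewrite /word_tape (nth_map true) ?size_nseq // nth_nseq td.
have := sweep_control_correct (sweep_at t).
rewrite /tm_step /= !ffunE x0 h0 x1 h1 xq input_t.
case: (sweep_control _ _) => [[q o] [a dir]] [qE oE headE tapeE].
eexists; first by [].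
rewrite /sweep_invariant /=; split; rewrite ?sweep_atS //; split=> /=.
- move=> i; rewrite x0 h0; case: eqP => // ->.
  by rewrite input_t.
- by move=> i; rewrite h1 x1 tapeE.
- move=> i; rewrite h2 x2 oE -/(sweep_bit t) mkseqS /= -[mkseq _ t]revK.
  by rewrite -[rcons _ _]cats1 -word_tape_append size_rev size_mkseq.
- by rewrite h0; lia.
- by rewrite h1.
- by rewrite h2; lia.
Qed.

Definition sweep_tuple (d : nat) : d.-tuple bool :=
  mktuple (fun i : 'I_d => sweep_bit i).

Lemma sweep_tupleE d : sweep_tuple d = mkseq sweep_bit d :> seq bool.
Proof. by rewrite /= /mkseq -val_enum_ord -map_comp. Qed.

Lemma sweep_explicit : explicit sweep_tuple.
Proof.
exists sweep_machine, 1 => d.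
suff [x xE [_ [_ _ x2] _]] : exists2 x,
    tm_run (1 * d.+1 ^ 1) (tm_init sweep_machine (nseq d true)) = Some x
    & sweep_invariant d d x.
  by exists x => // i; rewrite x2 sweep_tupleE.
rewrite mul1n expn1.
suff run n t x : t + n = d -> sweep_invariant d t x ->
    exists2 y, tm_run n.+1 x = Some y & sweep_invariant d d y.
  by apply: (@run d 0) => //; exact: sweep_invariant_init.
elim: n t x => [|n IHn] t x td xt.
  have {}td : t = d by lia.
  rewrite td in xt; exists x => //=.
  by rewrite (sweep_invariant_halt xt).
have [|y xy yt] := sweep_invariant_step _ xt; first by lia.
have [|z zy zt] := IHn _ _ _ yt; first by lia.
by exists z => //; rewrite -zy /= xy.
Qed.

(** * Windows of non-commutative polynomials *)

Local Open Scope ring_scope.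

Section Windows.
Variables (F : fieldType) (I : finType) (k : nat).
Implicit Types (p q : ncpoly F I) (i : nat) (m : {fmonom I}).

Definition slice i (s : seq I) : seq I := take k (drop i s).

(* The polynomial p_i, given by its coefficients on the words of length k. *)
Definition window i p : {ffun k.-tuple I -> F^o} :=
  [ffun t : k.-tuple I =>
     mmap idfun (fun m : {fmonom I} => (slice i m == t)%:R : F) p].

Lemma windowD i p q : window i (p + q) = window i p + window i q.
Proof. by apply/ffunP => t; rewrite !ffunE mmapD. Qed.

Lemma windowZ i a p : window i (a *: p) = a *: window i p.
Proof.
apply/ffunP => t; rewrite !ffunE (mmapEw (msuppZ_le a p)) mmapE.
rewrite /GRing.scale/= mulr_sumr; apply: eq_bigr => m _.
by rewrite mcoeffZ mulrA.
Qed.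

Lemma windowU_short i a m : (size m < k)%N -> window i << a *g m >> = 0.
Proof.
move=> mk; apply/ffunP => t; rewrite !ffunE mmapU.
case: eqP => [mt|_]; last by rewrite mulr0.
move: (size_tuple t); rewrite -mt /slice => kE.
by move: mk; rewrite -kE ltnNge size_take_min size_drop geq_min leq_subr orbT.
Qed.

Lemma windowM i p q (t : k.-tuple I) : window i (p * q) t =
  \sum_(m1 <- msupp p) \sum_(m2 <- msupp q)
    p@_m1 * q@_m2 * (slice i (m1 ++ m2) == t)%:R.
Proof.
rewrite ffunE malgME raddf_sum /=; apply: eq_bigr => m1 _.
rewrite raddf_sum /=; apply: eq_bigr => m2 _.
by rewrite mmapU fmM.
Qed.

(** All junctions lie at position [a], and setting the variables of [q] to 1 leaves the sum of its
    coefficients. *)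
Lemma windowM_left i a p q : (forall m, m \in msupp p -> fdeg m = a) ->
  (i + k <= a)%N ->
  window i (p * q) = (\sum_(m <- msupp q) q@_m) *: window i p.
Proof.
move=> pa ika; apply/ffunP => t; rewrite windowM !ffunE mmapE.
rewrite /GRing.scale/= mulr_sumr [LHS]big_seq [RHS]big_seq.
apply: eq_bigr => m1 /pa; rewrite fdegE => m1a.
rewrite mulr_suml; apply: eq_bigr => m2 _.
rewrite /slice drop_cat m1a.
case: ltnP => [ia|ai].
  by rewrite takel_cat ?size_drop ?m1a 1?mulrCA ?mulrA // leq_subRL // ltnW.
(* Here i + k <= a <= i, which forces k = 0. *)
have take_k (s : seq I) : take k s = [::].
  by rewrite (_ : k = 0%N) ?take0 //; lia.
by rewrite !take_k mulrCA mulrA.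
Qed.

Lemma windowM_right i a p q : (forall m, m \in msupp p -> fdeg m = a) ->
  window (a + i) (p * q) = (\sum_(m <- msupp p) p@_m) *: window i q.
Proof.
move=> pa; apply/ffunP => t; rewrite windowM !ffunE mmapE.
rewrite /GRing.scale/= mulr_suml [LHS]big_seq [RHS]big_seq.
apply: eq_bigr => m1 /pa; rewrite fdegE => m1a.
rewrite mulr_sumr; apply: eq_bigr => m2 _.
by rewrite /slice drop_cat m1a ltnNge leq_addr addKn mulrA.
Qed.

Lemma windowMC i p a : window i (p * a%:MP) = a *: window i p.
Proof.
apply/ffunP => t; rewrite windowM !ffunE mmapE /GRing.scale/= mulr_sumr.
apply: eq_bigr => m _.
have [->|a0] := eqVneq a 0; first by rewrite msuppC0 big_seq_fset0 mul0r.
by rewrite msuppC (negPf a0) big_seq_fset1 mcoeffC eqxx fm1 cats0 -mulrA mulrCA.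
Qed.

Lemma ncmonomialE (s : seq I) : ncmonomial F s = << FMonom s >>.
Proof.
rewrite /ncmonomial; elim: s => [|x s IHs]; first by rewrite big_nil -fmoneE.
rewrite big_cons IHs /ncvar malgM_def fgmulUU mulr1 fmuE.
by congr << _ *g _ >>; apply/eqP; rewrite fmP fmM.
Qed.

Lemma window_ncmonomial i (s : seq I) (t : k.-tuple I) :
  window i (ncmonomial F s) t = (slice i s == t)%:R.
Proof. by rewrite ffunE ncmonomialE mmapU mul1r. Qed.

End Windows.

(** * Dimension of the span of the windows of a circuit *)

Section CircuitWindows.
Variables (F : fieldType) (I : finType) (C : circuit F I).

(** By acyclicity the set of gates below shrinks strictly along a wire. *)
Lemma circuit_ind (P : gate C -> Prop) :
  (forall v, (forall u, wire (label C) u v -> P u) -> P v) -> forall v, P v.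
Proof.
move=> IH v; pose below w := [set u | connect (wire (label C)) u w].
have [n] := ubnP #|below v|; elim: n v => // n IHn v; rewrite ltnS => vn.
apply: IH => u uv; apply: IHn; apply: leq_trans vn.
apply/proper_card/properP; split.
  by apply/subsetP => w; rewrite !inE => /connect_trans-> //; exact: connect1.
by exists v; rewrite !inE ?connect0 // acyclic.
Qed.

Lemma gate_windows_span k : (1 < k)%N -> homogeneous_circuit C ->
  exists2 X : seq {ffun k.-tuple I -> F^o},
    (size X <= k.-1 * nonscalar_size C)%N
    & forall (v : gate C) i, window k i (gate_poly v) \in <<X>>%VS.
Proof.
move=> k1 /fin_all_exists [deg degP].
pose cut v := if label C v is Prod l _ then deg l else 0%N.
pose S := enum [set v : gate C | nonscalar v].
(* These are the windows straddling the junction; truncation at 0 merely adds harmless entries. *)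
pose X := [seq window k (cut v - j) (gate_poly v) | v <- S, j <- iota 1 k.-1].
exists X => [|v].
  by rewrite size_allpairs size_iota mulnC /S -cardE.
elim/circuit_ind: v => v IHv i.
rewrite gate_polyE; case labv : (label C v) => [x|a|l r|l r].
- by rewrite windowU_short ?mem0v //= fmuE.
- by rewrite windowU_short ?mem0v //= fm1 ltnW.
- by rewrite windowD memvD ?IHv // /wire labv eqxx ?orbT.
have [lX rX] : (forall i, window k i (gate_poly l) \in <<X>>%VS) /\
    (forall i, window k i (gate_poly r) \in <<X>>%VS).
  by split; apply: IHv; rewrite /wire labv eqxx ?orbT.
have [/eqP->|lnC] := boolP (constant_poly (gate_poly l)).
  by rewrite mul_malgC windowZ memvZ.
have [/eqP->|rnC] := boolP (constant_poly (gate_poly r)).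
  by rewrite windowMC memvZ.
have [ik|ki] := leqP (i + k) (deg l).
  by rewrite (windowM_left _ (degP l)) // memvZ.
have [li|il] := leqP (deg l) i.
  by rewrite -(subnKC li) (windowM_right _ _ _ (degP l)) memvZ.
(* Now i < deg l < i + k, so j = deg l - i lies between 1 and k - 1. *)
have vS : v \in S.
  by rewrite mem_enum in_set /nonscalar labv; exact/andP.
apply: memv_span; apply/allpairsP; exists (v, deg l - i)%N => /=; split.
- exact: vS.
- by rewrite mem_iota; lia.
- by rewrite /cut labv (gate_polyE v) labv subKn // ltnW.
Qed.

Lemma distinct_slices_le (k : nat) (s : seq I) (ps : seq nat) :
    (1 < k)%N -> homogeneous_circuit C -> computes C (ncmonomial F s) ->
    {in ps, forall i, i + k <= size s}%N -> uniq [seq slice k i s | i <- ps] ->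
  (size ps <= k.-1 * nonscalar_size C)%N.
Proof.
move=> k1 homC [v vE] pss us.
have [X sX Xw] := gate_windows_span k1 homC.
apply: leq_trans sX; apply: leq_trans (dim_span X).
pose Y := [seq window k i (ncmonomial F s) | i <- ps].
have sY : size Y = size ps by rewrite size_map.
have YX : (<<Y>> <= <<X>>)%VS.
  by apply/span_subvP => _ /mapP [i _ ->]; rewrite -vE.
apply: leq_trans (dimvS YX); rewrite -sY; suff /eqP-> : free Y by [].
apply/(@freeP _ _ _ (in_tuple Y)) => a a0 j.
have jps : (j < size ps)%N by rewrite -sY.
pose i := nth 0%N ps j.
have szi : size (slice k i s) == k.
  have := pss _ (mem_nth 0%N jps); rewrite -/i => ik.
  by rewrite size_take_min size_drop; apply/eqP/minn_idPl; lia.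
(* Evaluated at the [j]-th slice, the linear relation retains only the coefficient [a j], as the
   slices are distinct. *)
have /ffunP/(_ (Tuple szi)) := a0; rewrite sum_ffunE ffunE (bigD1 j) //=.
rewrite big1 ?addr0 => [|j' j'j].
  rewrite ffunE (nth_map 0%N) // window_ncmonomial /= eqxx.
  by rewrite /GRing.scale/= mulr1.
have j'ps : (j' < size ps)%N by rewrite -sY.
rewrite ffunE (nth_map 0%N) // window_ncmonomial /= /i.
rewrite -!(nth_map 0%N [::] (fun i => slice k i s)) //.
have ss : size [seq slice k i s | i <- ps] = size ps by rewrite size_map.
by rewrite nth_uniq ?ss // val_eqE (negPf j'j) scaler0.
Qed.

End CircuitWindows.

(** * The lower bound *)

Definition sweep_width (d : nat) : nat := (5 * trunc_log 2 d.+2 + 7)%N.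

(** A numeral of p digits is at least 2^p - 1, and the counter is at most t + 1 at time [t]. *)
Lemma size_pending_le t d : (t <= d)%N ->
  (size (pending (sweep_at t)) <= trunc_log 2 d.+2)%N.
Proof.
move=> td; apply: trunc_log_max => //.
have := expn2_size_numeral (pending (sweep_at t)).
by have := numeral_val_pending t; lia.
Qed.

Lemma sweep_slice_inj d i j : (i + sweep_width d <= d)%N ->
  (j + sweep_width d <= d)%N ->
  slice (sweep_width d) i (sweep_tuple d) =
    slice (sweep_width d) j (sweep_tuple d) ->
  i = j.
Proof.
move=> id jd eq_ij; apply: (@sweep_window_inj (sweep_width d)) => [|n nk].
  by have := @size_pending_le i d; rewrite /sweep_width; lia.
have := congr1 (nth false ^~ n) eq_ij.
by rewrite /slice !sweep_tupleE !nth_take // !nth_drop !nth_mkseq //; lia.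
Qed.

Lemma sweep_nonscalar_size_ge (F : fieldType) (d : nat) (C : circuit F bool) :
    (1 < d)%N -> homogeneous_circuit C ->
    computes C (ncmonomial F (sweep_tuple d)) ->
  (d <= 2 * sweep_width d * nonscalar_size C)%N.
Proof.
move=> d1 homC compC.
(* A single window of length 2 already requires one product; this settles d < 2 *
   [sweep_width d]. *)
have s_gt0 : (0 < nonscalar_size C)%N.
  have := @distinct_slices_le _ _ C 2 _ [:: 0%N] isT homC compC.
  by rewrite mul1n; apply => // i; rewrite inE size_tuple => /eqP->.
have k1 : (1 < sweep_width d)%N by rewrite /sweep_width; lia.
have [kd|dk] := leqP (2 * sweep_width d) d; last by nia.
(* There are d - [sweep_width d] + 1 windows, more than d / 2. *)
suff : (d - sweep_width d < (sweep_width d).-1 * nonscalar_size C)%N by nia.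
rewrite -[X in (X <= _)%N](size_iota 0).
apply: (distinct_slices_le k1 homC compC) => [i|].
  by rewrite mem_iota size_tuple; lia.
rewrite map_inj_in_uniq ?iota_uniq // => i j; rewrite !mem_iota => id jd.
by apply: sweep_slice_inj; lia.
Qed.

(** Since d + 2 <= d^2, the logarithm contributes at most 2 ln d, and 17 = 5 * 2 + 7. *)
Lemma sweep_width_ln (R : realType) d : (1 < d)%N ->
  (sweep_width d)%:R * ln 2 <= 17 * ln d%:R :> R.
Proof.
move=> d1.
have d0 : 0 < d%:R :> R by rewrite ltr0n ltnW.
have ln2d : ln 2 <= ln d%:R :> R by rewrite ler_ln ?posrE // ler_nat.
have : (trunc_log 2 d.+2)%:R * ln 2 <= 2 * ln d%:R :> R.
  rewrite !mulr_natl -!lnXn // ler_ln ?posrE ?exprn_gt0 // -!natrX ler_nat.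
  apply: leq_trans (trunc_logP _ _) _ => //.
  by nia.
rewrite /sweep_width natrD natrM; lra.
Qed.

Theorem theorem3p1 (R : realType) (F : fieldType) :
  exists2 sigma : forall d : nat, d.-tuple bool,
    explicit sigma
    & exists2 c : R, 0 < c
      & forall d : nat, (1 < d)%N ->
        forall C : circuit F bool,
          homogeneous_circuit C -> computes C (ncmonomial F (sigma d)) ->
          c * (d%:R / ln d%:R) <= (nonscalar_size C)%:R.
Proof.
exists sweep_tuple; first exact: sweep_explicit.
have ln2_gt0 : 0 < ln 2 :> R by rewrite ln_gt0 // ltr1n.
(* 34 is 2 * 17, from d <= 2ws and w ln 2 <= 17 ln d, with w the window length and s the non-scalar
   size. *)
exists (ln 2 / 34); first by rewrite divr_gt0.
move=> d d1 C homC compC.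
have lnd_gt0 : 0 < ln d%:R :> R by rewrite ln_gt0 // ltr1n.
rewrite mulrA ler_pdivrMr // mulrAC ler_pdivrMr //.
have ds : d%:R <= 2 * (sweep_width d)%:R * (nonscalar_size C)%:R :> R.
  by rewrite -!natrM ler_nat sweep_nonscalar_size_ge.
apply: le_trans (ler_wpM2l (ltW ln2_gt0) ds) _.
have := ler_wpM2l (ler0n R (2 * nonscalar_size C)) (sweep_width_ln R d1).
by rewrite natrM; lra.
Qed.
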